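(* Let $n_1,\ldots,n_d$ be positive integers and let $\eta$ be a $(d-2)$-dimensional partition with $D(\eta)\subseteq[n_2]\times\cdots\times[n_d]$. Let $D(n_1\times\eta)=\{(i,\mathbf{i}): i\in[n_1],\ \mathbf{i}\in D(\eta)\}\subset\mathbb{Z}_+^d$. Then $$\sum_{\rho} g_{\rho}(\mathbf{x}^{(1)}; \ldots; \mathbf{x}^{(d)}) = \prod_{(i_1,\ldots, i_d) \in D(n_1 \times \eta)} \left(1 - x^{(1)}_{i_1} \cdots x^{(d)}_{i_d} \right)^{-1},$$ where the sum runs over all $(d-1)$-dimensional partitions $\rho$ with $\mathrm{sh}(\rho)\subseteq D(\eta)$.
   Context: A $k$-dimensional partition is an array $\pi=(\pi_{\mathbf{i}})_{\mathbf{i}\in\mathbb{Z}_+^k}$ of nonnegative integers with finitely many nonzero entries, weakly decreasing in each coordinate; its diagram is $D(\pi)=\{(\mathbf{i},i)\in\mathbb{Z}_+^{k+1}:1\le i\le\pi_{\mathbf{i}}\}$ and its shape $\mathrm{sh}(\pi)=\{\mathbf{i}:\pi_{\mathbf{i}}>0\}$. For a $d$-dimensional partition $\pi$: $\mathrm{Cor}(\pi)=\{\mathbf{i}\in D(\pi):\mathbf{i}+\mathbf{e}_\ell\notin D(\pi)\ \forall\ell\in[d]\}$ ($\mathbf{e}_\ell$ standard basis of $\mathbb{Z}^{d+1}$), and $\mathrm{sh}_1(\pi)=\{(i_2,\ldots,i_{d+1}):(i_1,\ldots,i_{d+1})\in D(\pi)\}\subset\mathbb{Z}_+^d$. Variables: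 $\mathbf{x}^{(k)}=(x^{(k)}_1,\ldots,x^{(k)}_{n_k})$, $k\in[d]$. For a $(d-1)$-dimensional partition $\rho$ with $D(\rho)\subseteq[n_2]\times\cdots\times[n_d]\times\mathbb{Z}_+$, the $d$-dimensional Grothendieck polynomial is $g_\rho(\mathbf{x}^{(1)};\ldots;\mathbf{x}^{(d)})=\sum_{\pi}\prod_{(i_1,\ldots,i_{d+1})\in\mathrm{Cor}(\pi)}x^{(1)}_{i_1}\cdots x^{(d)}_{i_d}$, summed over $d$-dimensional partitions $\pi$ with $D(\pi)\subseteq[n_1]\times\cdots\times[n_d]\times\mathbb{Z}_+$ and $\mathrm{sh}_1(\pi)=D(\rho)$. *)

(* Defs.v *)
From HB Require Import structures.
From mathcomp Require Import all_boot all_order all_algebra.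
From mathcomp Require Import finmap.
From mathcomp Require Import boolp classical_sets cardinality fsbigop.
From mathcomp Require Import mpoly.

Set Implicit Arguments.
Unset Strict Implicit.
Unset Printing Implicit Defensive.

Import GRing.Theory.
Local Open Scope fset_scope.
Local Open Scope ring_scope.

Record fps (n : nat) (R : Type) := FPS { fps_coef : 'X_{1..n} -> R }.

Section FPSRing.
Variables (n : nat) (R : comNzRingType).
Implicit Types f g h : fps n R.

HB.instance Definition _ := gen_eqMixin (fps n R).
HB.instance Definition _ := gen_choiceMixin (fps n R).

Lemma fpsP f g : (forall m, fps_coef f m = fps_coef g m) -> f = g.
Proof. by case: f g => [f] [g] /= /funext ->. Qed.

Definition fps_zero : fps n R := FPS (fun=> 0).
Definition fps_one : fps n R := FPS (fun m => (m == 0%MM)%:R).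
Definition fps_opp f : fps n R := FPS (fun m => - fps_coef f m).
Definition fps_add f g : fps n R := FPS (fun m => fps_coef f m + fps_coef g m).

(* Cauchy product; both components of [k] range over the (finite) type of
   monomials of degree at most [mdeg m]. *)
Definition fps_mul f g : fps n R := FPS (fun m =>
  \sum_(k : 'X_{1..n < (mdeg m).+1, (mdeg m).+1} | m == (k.1 + k.2)%MM)
     fps_coef f k.1 * fps_coef g k.2).

Fact fps_addA : associative fps_add.
Proof. by move=> f g h; apply: fpsP => m; rewrite /= addrA. Qed.
Fact fps_addC : commutative fps_add.
Proof. by move=> f g; apply: fpsP => m; rewrite /= addrC. Qed.
Fact fps_add0 : left_id fps_zero fps_add.
Proof. by move=> f; apply: fpsP => m; rewrite /= add0r. Qed.
Fact fps_addN : left_inverse fps_zero fps_opp fps_add.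
Proof. by move=> f; apply: fpsP => m; rewrite /= addNr. Qed.

HB.instance Definition _ := GRing.isZmodule.Build (fps n R)
  fps_addA fps_addC fps_add0 fps_addN.

Definition fps_of_mpoly (p : {mpoly R[n]}) : fps n R := FPS (fun m => p@_m).

Let trunc (b : nat) f : {mpoly R[n]} :=
  \sum_(m : 'X_{1..n < b}) fps_coef f m *: 'X_[m].

Let truncE b f m : (mdeg m < b)%N -> (trunc b f)@_m = fps_coef f m.
Proof. exact: mcoeff_mpoly. Qed.

Let eq_mcoeffM (p q : {mpoly R[n]}) f g m :
    (forall m', (mdeg m' <= mdeg m)%N -> p@_m' = fps_coef f m') ->
    (forall m', (mdeg m' <= mdeg m)%N -> q@_m' = fps_coef g m') ->
  (p * q)@_m = fps_coef (fps_mul f g) m.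
Proof.
move=> pf qg; rewrite mcoeffM /=; apply: eq_bigr => k _.
by rewrite pf ?qg // -ltnS ?bmdeg.
Qed.

Let mul_truncE b f g m : (mdeg m < b)%N ->
  (trunc b f * trunc b g)@_m = fps_coef (fps_mul f g) m.
Proof.
by move=> mb; apply: eq_mcoeffM => m' m'm; apply: truncE; apply: leq_ltn_trans mb.
Qed.

Fact fps_mulA : associative fps_mul.
Proof.
move=> f g h; apply: fpsP => m; pose b := (mdeg m).+1.
have lt_b m' : (mdeg m' <= mdeg m)%N -> (mdeg m' < b)%N by rewrite ltnS.
transitivity ((trunc b f * (trunc b g * trunc b h))@_m).
  by symmetry; apply: eq_mcoeffM => m' /lt_b ?; rewrite ?truncE ?mul_truncE.
by rewrite mulrA; apply: eq_mcoeffM => m' /lt_b ?; rewrite ?truncE ?mul_truncE.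
Qed.

Fact fps_mulC : commutative fps_mul.
Proof.
move=> f g; apply: fpsP => m; have lt_mb := ltnSn (mdeg m).
by rewrite -!(mul_truncE _ _ lt_mb) mulrC.
Qed.

Fact fps_mul1 : left_id fps_one fps_mul.
Proof.
move=> f; apply: fpsP => m; have lt_mb := ltnSn (mdeg m).
rewrite -(truncE f lt_mb) -[RHS](congr1 (mcoeff m) (mul1r _)).
symmetry; apply: eq_mcoeffM => m' m'm; first by rewrite mcoeff1.
by rewrite truncE.
Qed.

Fact fps_mulDl : left_distributive fps_mul fps_add.
Proof.
move=> f g h; apply: fpsP => m /=; rewrite -big_split /=.
by apply: eq_bigr => k _; rewrite mulrDl.
Qed.

Fact fps_oner_neq0 : fps_one != 0 :> fps n R.
Proof.
apply/eqP => /(congr1 (fun f => fps_coef f 0%MM)) /= /eqP.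
by rewrite eqxx oner_eq0.
Qed.

HB.instance Definition _ := GRing.Zmodule_isComNzRing.Build (fps n R)
  fps_mulA fps_mulC fps_mul1 fps_mulDl fps_oner_neq0.

Definition fps_unit : {pred fps n R} := fun f => `[< exists g, g * f = 1 >].

Definition fps_inv f : fps n R :=
  if pselect (exists g, g * f = 1) is left e then sval (cid e) else f.

Fact fps_mulVf : {in fps_unit, left_inverse 1 fps_inv *%R}.
Proof.
move=> f /asboolP fU; rewrite /fps_inv; case: pselect => // e.
by case: cid.
Qed.

Fact fps_unitP f g : g * f = 1 -> fps_unit f.
Proof. by move=> gf1; apply/asboolP; exists g. Qed.

Fact fps_inv_out : {in [predC fps_unit], fps_inv =1 id}.
Proof. by move=> f /asboolPn nU; rewrite /fps_inv; case: pselect. Qed.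

HB.instance Definition _ := GRing.ComNzRing_hasMulInverse.Build (fps n R)
  fps_mulVf fps_unitP fps_inv_out.

(* Infinite sums of power series: every monomial receives a contribution from
   finitely many members of the family, and coefficients are added. *)
Definition fps_summable (T : choiceType) (A : set T) (F : T -> fps n R) : Prop :=
  forall m, finite_set [set t | A t /\ fps_coef (F t) m <> 0]%classic.

Definition fps_sum (T : choiceType) (A : set T) (F : T -> fps n R) : fps n R :=
  FPS (fun m => \sum_(t \in A) fps_coef (F t) m).

End FPSRing.

(* Coordinates in Z_+ = {1, 2, ...} are all shifted down by one, so that points
   of Z_+^k are [k.-tuple nat] and [n] = {1, ..., n} becomes {0, ..., n - 1}. *)

Definition addE k (l : 'I_k) (u : k.-tuple nat) : k.-tuple nat :=
  [tuple (tnth u j + (j == l))%N | j < k].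

Definition weakly_decreasing k (f : k.-tuple nat -> nat) : Prop :=
  forall (i : k.-tuple nat) (l : 'I_k), (f (addE l i) <= f i)%N.

Record hpartition (k : nat) := HPartition {
  part_fun :> {fsfun k.-tuple nat -> nat with 0%N};
  _ : `[< weakly_decreasing part_fun >] }.

HB.instance Definition _ k := [isSub for @part_fun k].
HB.instance Definition _ k := [Choice of hpartition k by <:].

Definition hdiagram k (p : hpartition k) : {fset k.+1.-tuple nat} :=
  [fset rcons_tuple i h | i in finsupp p, h in iota 0 (p i)].

Definition hshape k (p : hpartition k) : {fset k.-tuple nat} := finsupp p.

Definition hshape1 k (p : hpartition k) : {fset k.-tuple nat} :=
  [fset behead_tuple u | u in hdiagram p].

Definition hcorners k (p : hpartition k) : {fset k.+1.-tuple nat} :=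
  [fset u in hdiagram p |
    [forall l : 'I_k, addE (widen_ord (leqnSn k) l) u \notin hdiagram p]].

(* The diagram of [p] lies in [n_1] x ... x [n_k] x Z_+. *)
Definition hdiagram_in_box k (n : 'I_k -> nat) (p : hpartition k) : Prop :=
  forall u, u \in hdiagram p ->
  forall l : 'I_k, (tnth u (widen_ord (leqnSn k) l) < n l)%N.

Lemma mem_hdiagram k (p : hpartition k) (i : k.-tuple nat) (h : nat) :
  (rcons_tuple i h \in hdiagram p) = (h < p i)%N.
Proof.
apply/imfset2P/idP => [[/= j _ [h']]|hp].
  rewrite mem_iota add0n /= => h'p /(congr1 val) /= /eqP.
  by rewrite eqseq_rcons => /andP[/eqP/val_inj -> /eqP ->].
exists i; first by rewrite mem_finsupp -lt0n (leq_ltn_trans _ hp).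
by exists h => //; rewrite mem_iota.
Qed.

Lemma hdiagram_inj k : injective (@hdiagram k).
Proof.
move=> p q pq; apply: val_inj; apply/fsfunP => i.
apply/eqP; rewrite eqn_leq; apply/andP; split; rewrite leqNgt; apply/negP.
  by rewrite -(mem_hdiagram p) pq mem_hdiagram ltnn.
by rewrite -(mem_hdiagram q) -pq mem_hdiagram ltnn.
Qed.

Section Grothendieck.
Variable R : comNzRingType.

Definition vars d (n : 'I_d -> nat) : finType := {k : 'I_d & 'I_(n k)}.

(* [xvar n k j] is the variable x^(k)_j, extended by 0 to j outside [n_k]. *)
Definition xvar d (n : 'I_d -> nat) (k : 'I_d) (j : nat) :
    {mpoly R[#|vars n|]} :=
  if (insub j : option 'I_(n k)) is Some j' then
    'X_(enum_rank (Tagged (fun l => 'I_(n l)) j' : vars n))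
  else 0.

Definition gindex d (n : 'I_d.+1 -> nat) (rho : hpartition d) :
    set (hpartition d.+1) :=
  [set pi | hdiagram_in_box n pi /\ hshape1 pi = hdiagram rho]%classic.

Definition grothendieck d (n : 'I_d.+1 -> nat) (rho : hpartition d) :
    {mpoly R[#|vars n|]} :=
  \sum_(pi \in gindex n rho)
    \prod_(u <- hcorners pi)
      \prod_(k < d.+1) xvar n k (tnth u (widen_ord (leqnSn d.+1) k)).

(* So the convention giving 0 to sums of infinite support is never used in
   [grothendieck]. *)
Lemma finite_gindex d (n : 'I_d.+1 -> nat) (rho : hpartition d) :
  finite_set (gindex n rho).
Proof.
pose B : {fset d.+2.-tuple nat} :=
  [fset cons_tuple i u | i in iota 0 (n ord0), u in hdiagram rho].
apply: (@sub_finite_set _ _ (@hdiagram d.+1 @^-1` [set` fpowerset B])%classic).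
  move=> pi [box sh1]; rewrite /= fpowersetE; apply/fsubsetP => u uD.
  apply/imfset2P; exists (thead u).
    rewrite mem_iota /= add0n.
    have -> : thead u = tnth u (widen_ord (leqnSn d.+1) ord0).
      by rewrite /thead; congr tnth; apply: val_inj.
    exact: box.
  exists (behead_tuple u); last by rewrite {1}(tuple_eta u); apply: val_inj.
  by rewrite -sh1; apply/imfsetP; exists u.
apply: finite_preimage => [p q _ _|]; first exact: hdiagram_inj.
exact: finite_fset.
Qed.

End Grothendieck.

Definition prism k (n1 : nat) (D : {fset k.-tuple nat}) :
    {fset k.+1.-tuple nat} :=
  [fset cons_tuple i u | i in iota 0 n1, u in D].

(* Main.v *)
(* Taking the union over [rho], the left-hand side is a sum over all partitions
   [pi] whose support lies in the down-closed set [B = n_1 x D(eta)].  Above a point [i]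
   the corners of [pi] are the heights from [max_l pi (i + e_l)] up to [pi i], so
   [pi] has weight [\prod_(i in B) x_i ^ a_i] with
   [a_i = pi i - max_l pi (i + e_l)].  The last-passage recursion
   [pi i = a_i + max_l pi (i + e_l)] recovers [pi] from an arbitrary [a : B -> nat],
   and summing over all [a] gives the product of the geometric series
   [1 / (1 - x_i)]. *)

Require Import Defs.
From mathcomp Require Import all_boot all_order all_algebra.
From mathcomp Require Import finmap.
From mathcomp Require Import boolp classical_sets cardinality fsbigop.
From mathcomp Require Import mpoly.

Set Implicit Arguments.
Unset Strict Implicit.
Unset Printing Implicit Defensive.

Import GRing.Theory.
Local Open Scope ring_scope.

(** * Power series up to a degree, and the geometric series *)

Section PowerSeries.
Variables (n : nat) (R : comNzRingType).
Implicit Types (f g : fps n R) (N : nat).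

(** Congruence modulo the [N]-th power of the ideal generated by the variables. *)
Definition fps_eq_upto N f g : Prop :=
  forall m, (mdeg m < N)%N -> fps_coef f m = fps_coef g m.

Lemma fps_eq_upto_refl N f : fps_eq_upto N f f.
Proof. by []. Qed.

Lemma fps_eq_uptoM N f f' g g' :
  fps_eq_upto N f f' -> fps_eq_upto N g g' -> fps_eq_upto N (f * g) (f' * g').
Proof.
move=> ff' gg' m mN; apply: eq_bigr => k _.
by rewrite ff' ?gg' //; apply: leq_trans mN; apply: bmdeg.
Qed.

Lemma fps_eq_upto_prod (I : Type) (s : seq I) (F G : I -> fps n R) N :
    (forall i, fps_eq_upto N (F i) (G i)) ->
  fps_eq_upto N (\prod_(i <- s) F i) (\prod_(i <- s) G i).
Proof.
move=> FG; elim/big_rec2: _ => // i f g _ fg.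
exact: fps_eq_uptoM.
Qed.

(** Orders of vanishing add: when a monomial of degree below [N + M] is split in two, the first part
    has degree below [N] or the second below [M]. *)
Lemma fps_eq_upto_mul0 N M f g :
  fps_eq_upto N f 0 -> fps_eq_upto M g 0 -> fps_eq_upto (N + M) (f * g) 0.
Proof.
move=> f0 g0 m; rewrite [fps_coef 0 m]/= => mNM; apply: big1 => k /eqP mk.
have [k1N|Nk1] := ltnP (mdeg k.1) N; first by rewrite f0 // mul0r.
rewrite g0 ?mulr0 // -(ltn_add2l N); apply: leq_ltn_trans mNM.
by rewrite [X in (_ <= X)%N](congr1 (@mdeg n) mk) mdegD leq_add2r.
Qed.

Lemma fps_eq_upto_expr0 N f : fps_coef f 0%MM = 0 -> fps_eq_upto N (f ^+ N) 0.
Proof.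
move=> f0; elim: N => [//|N IHN]; rewrite exprS -add1n; apply: fps_eq_upto_mul0 => //.
by move=> m; rewrite ltnS leqn0 mdeg_eq0 => /eqP ->.
Qed.

Lemma fps_coefN f m : fps_coef (- f) m = - fps_coef f m. Proof. by []. Qed.
Lemma fps_coefD f g m : fps_coef (f + g) m = fps_coef f m + fps_coef g m.
Proof. by []. Qed.

Lemma fps_coef_sum (I : Type) (s : seq I) (F : I -> fps n R) m :
  fps_coef (\sum_(i <- s) F i) m = \sum_(i <- s) fps_coef (F i) m.
Proof. exact: (big_morph (fun f => fps_coef f m)). Qed.

Lemma fps_eq_upto_1subX N f : fps_coef f 0%MM = 0 -> fps_eq_upto N (1 - f ^+ N) 1.
Proof.
move=> f0 m mN; rewrite fps_coefD fps_coefN (fps_eq_upto_expr0 f0 mN).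
by rewrite [fps_coef 0 m]/= subr0.
Qed.

Lemma geometric_sumE N f : (1 - f) * (\sum_(j < N) f ^+ j) = 1 - f ^+ N.
Proof. by rewrite -opprB mulNr -subrX1 opprB. Qed.

Lemma fps_1sub_unit f : fps_coef f 0%MM = 0 -> 1 - f \is a GRing.unit.
Proof.
move=> f0.
(* The infinite geometric series: powers beyond [mdeg m] vanish at [m], so each coefficient is read
   off a finite partial sum. *)
pose g : fps n R := FPS (fun m => fps_coef (\sum_(j < (mdeg m).+1) f ^+ j) m).
have gE N : fps_eq_upto N g (\sum_(j < N) f ^+ j).
  move=> m mN; rewrite /= -(subnKC mN) big_split_ord fps_coefD /=.
  rewrite [X in _ + X](_ : _ = 0) ?addr0 // fps_coef_sum; apply: big1 => j _.
  by apply: (fps_eq_upto_expr0 f0 (N := _ + j)); rewrite ltnS leq_addr.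
apply/unitrPr; exists g; apply: fpsP => m.
have mN := ltnSn (mdeg m).
rewrite (fps_eq_uptoM (@fps_eq_upto_refl _ _) (gE (mdeg m).+1) mN).
by rewrite geometric_sumE fps_eq_upto_1subX.
Qed.

(** Multiplying the partial sum by [1 - f] gives [1 - f ^+ N], which is 1 below degree [N]. *)
Lemma fps_inv_geometric N f : fps_coef f 0%MM = 0 ->
  fps_eq_upto N (1 - f)^-1 (\sum_(j < N) f ^+ j).
Proof.
move=> f0 m mN; have fU := fps_1sub_unit f0.
rewrite -[X in _ = fps_coef X m](mulKr fU) geometric_sumE -[X in fps_coef X m = _]mulr1.
by symmetry; apply: (fps_eq_uptoM _ _ mN) => //; apply: fps_eq_upto_1subX.
Qed.

Lemma fps_of_mpolyM (p q : {mpoly R[n]}) :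
  fps_of_mpoly (p * q) = fps_of_mpoly p * fps_of_mpoly q.
Proof. by apply: fpsP => m; rewrite /= mcoeffM. Qed.

Lemma fps_of_mpoly1 : fps_of_mpoly (1 : {mpoly R[n]}) = 1.
Proof. by apply: fpsP => m; rewrite /= mcoeff1. Qed.

Lemma fps_of_mpoly_prod (I : Type) (s : seq I) (F : I -> {mpoly R[n]}) :
  fps_of_mpoly (\prod_(i <- s) F i) = \prod_(i <- s) fps_of_mpoly (F i).
Proof. exact: (big_morph _ fps_of_mpolyM fps_of_mpoly1). Qed.

Lemma fps_of_mpolyX (p : {mpoly R[n]}) j :
  fps_of_mpoly (p ^+ j) = fps_of_mpoly p ^+ j.
Proof.
by elim: j => [|j IHj]; rewrite ?fps_of_mpoly1 // !exprS fps_of_mpolyM IHj.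
Qed.

(** Exponents of [N] or more cannot reach a monomial of degree below [N], so each factor is replaced
    by a geometric partial sum and the product is expanded. *)
Lemma fps_coef_prod_inv (I : finType) (F : I -> fps n R) N m :
    (forall i, fps_coef (F i) 0%MM = 0) -> (mdeg m < N)%N ->
  fps_coef (\prod_i (1 - F i)^-1) m =
  \sum_(a : {ffun I -> 'I_N}) fps_coef (\prod_i F i ^+ a i) m.
Proof.
move=> F0 mN; rewrite -fps_coef_sum -(bigA_distr_bigA (fun i (j : 'I_N) => F i ^+ j)).
by apply: (fps_eq_upto_prod _ _ mN) => i; apply: fps_inv_geometric.
Qed.

(** The factor [F i ^+ a i] alone vanishes to order [a i]; this later bounds the jumps of
    contributing partitions. *)
Lemma fps_coef_prod_expr_neq0 (I : finType) (F : I -> fps n R) (a : I -> nat) m i :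
    (forall i, fps_coef (F i) 0%MM = 0) ->
  fps_coef (\prod_i F i ^+ a i) m <> 0 -> (a i <= mdeg m)%N.
Proof.
move=> F0; rewrite leqNgt => nz; apply/negP => mi; apply: nz.
rewrite (bigD1 i) //=.
by apply: (fps_eq_upto_mul0 (M := 0) (fps_eq_upto_expr0 (F0 i))); rewrite ?addn0.
Qed.

End PowerSeries.

(** * Tuples with a coordinate added in front or at the end, and unit steps *)

Lemma tnth_rcons_widen k (i : k.-tuple nat) h (l : 'I_k) :
  tnth (rcons_tuple i h) (widen_ord (leqnSn k) l) = tnth i l.
Proof. by rewrite !(tnth_nth 0%N) /= nth_rcons size_tuple ltn_ord. Qed.

Lemma tnth_rcons_max k (i : k.-tuple nat) h : tnth (rcons_tuple i h) ord_max = h.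
Proof. by rewrite (tnth_nth 0%N) /= nth_rcons size_tuple ltnn eqxx. Qed.

Lemma tnth_cons0 k (i : k.-tuple nat) h : tnth (cons_tuple h i) ord0 = h.
Proof. by []. Qed.

Lemma tnth_cons_lift k (i : k.-tuple nat) h (l : 'I_k) :
  tnth (cons_tuple h i) (lift ord0 l) = tnth i l.
Proof. by rewrite !(tnth_nth 0%N). Qed.

Lemma rcons_tupleP k (u : k.+1.-tuple nat) : {i & {h | u = rcons_tuple i h}}.
Proof.
exists [tuple tnth u (widen_ord (leqnSn k) l) | l < k], (tnth u ord_max).
apply: eq_from_tnth => l; case: (unliftP ord_max l) => [l'|] ->; last first.
  by rewrite tnth_rcons_max.
have -> : lift ord_max l' = widen_ord (leqnSn k) l' by apply/val_inj/lift_max.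
by rewrite tnth_rcons_widen tnth_mktuple.
Qed.

Lemma cons_tupleP k (u : k.+1.-tuple nat) : {h & {i | u = cons_tuple h i}}.
Proof.
by exists (thead u), (behead_tuple u); rewrite {1}(tuple_eta u); apply: val_inj.
Qed.

Lemma cons_rcons_tuple k (i : k.-tuple nat) g h :
  cons_tuple g (rcons_tuple i h) = rcons_tuple (cons_tuple g i) h.
Proof. exact: val_inj. Qed.

Lemma rcons_tuple_inj k (i j : k.-tuple nat) g h :
  rcons_tuple i g = rcons_tuple j h -> i = j /\ g = h.
Proof. by move/(congr1 val) => /= /rcons_inj[/val_inj -> ->]. Qed.

Lemma cons_tuple_inj k (i j : k.-tuple nat) g h :
  cons_tuple g i = cons_tuple h j -> g = h /\ i = j.
Proof. by move/(congr1 val) => /= -[-> /val_inj ->]. Qed.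

Lemma addE_rcons_widen k (i : k.-tuple nat) h (l : 'I_k) :
  addE (widen_ord (leqnSn k) l) (rcons_tuple i h) = rcons_tuple (addE l i) h.
Proof.
apply: eq_from_tnth => j; rewrite tnth_mktuple.
case: (unliftP ord_max j) => [j'|] ->; last first.
  by rewrite !tnth_rcons_max -val_eqE /= gtn_eqF ?ltn_ord ?addn0.
have -> : lift ord_max j' = widen_ord (leqnSn k) j' by apply/val_inj/lift_max.
by rewrite !tnth_rcons_widen tnth_mktuple -val_eqE.
Qed.

Lemma addE_rcons_max k (i : k.-tuple nat) h :
  addE ord_max (rcons_tuple i h) = rcons_tuple i h.+1.
Proof.
apply: eq_from_tnth => j; rewrite tnth_mktuple.
case: (unliftP ord_max j) => [j'|] ->; last first.
  by rewrite !tnth_rcons_max eqxx addn1.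
have -> : lift ord_max j' = widen_ord (leqnSn k) j' by apply/val_inj/lift_max.
by rewrite !tnth_rcons_widen -val_eqE /= ltn_eqF ?ltn_ord ?addn0.
Qed.

Lemma addE_cons0 k (i : k.-tuple nat) h :
  addE ord0 (cons_tuple h i) = cons_tuple h.+1 i.
Proof.
apply: eq_from_tnth => j; rewrite tnth_mktuple.
case: (unliftP ord0 j) => [j'|] ->; last by rewrite !tnth_cons0 addn1.
by rewrite !tnth_cons_lift addn0.
Qed.

Lemma addE_cons_lift k (i : k.-tuple nat) h (l : 'I_k) :
  addE (lift ord0 l) (cons_tuple h i) = cons_tuple h (addE l i).
Proof.
apply: eq_from_tnth => j; rewrite tnth_mktuple.
case: (unliftP ord0 j) => [j'|] ->; last by rewrite !tnth_cons0 addn0.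
by rewrite !tnth_cons_lift tnth_mktuple (inj_eq lift_inj).
Qed.

Lemma sum_tnth_addE k (i : k.-tuple nat) (l : 'I_k) :
  (\sum_j tnth (addE l i) j = (\sum_j tnth i j).+1)%N.
Proof.
under eq_bigr do rewrite tnth_mktuple; rewrite big_split /= -addn1; congr (_ + _)%N.
by rewrite -big_mkcond /= big_pred1_eq.
Qed.

(** * Down-closed sets, diagrams and prisms *)

Definition down_closed k (B : {fset k.-tuple nat}) : Prop :=
  forall i l, addE l i \in B -> i \in B.

Lemma hpartition_decr k (p : hpartition k) : weakly_decreasing p.
Proof. by case: p => p /= /asboolP. Qed.

Lemma hdiagram_down_closed k (p : hpartition k) : down_closed (hdiagram p).
Proof.
move=> u l; case: (rcons_tupleP u) => i [h ->].
case: (unliftP ord_max l) => [l'|] ->; last first.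
  by rewrite addE_rcons_max !mem_hdiagram; apply: ltnW.
have -> : lift ord_max l' = widen_ord (leqnSn k) l' by apply/val_inj/lift_max.
by rewrite addE_rcons_widen !mem_hdiagram => /leq_trans; apply; apply: hpartition_decr.
Qed.

Lemma mem_prism k n1 (D : {fset k.-tuple nat}) h (i : k.-tuple nat) :
  (cons_tuple h i \in prism n1 D) = (h < n1)%N && (i \in D).
Proof.
apply/imfset2P/andP => /= [[h' h'n [i' i'D /cons_tuple_inj[-> ->]]]|[hn iD]].
  by move: h'n; rewrite mem_iota.
by exists h; [rewrite mem_iota | exists i].
Qed.

Lemma prism_down_closed k n1 (D : {fset k.-tuple nat}) :
  down_closed D -> down_closed (prism n1 D).
Proof.
move=> dD u l; case: (cons_tupleP u) => h [i ->].
case: (unliftP ord0 l) => [l'|] ->.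
  by rewrite addE_cons_lift !mem_prism => /andP[-> /dD].
by rewrite addE_cons0 !mem_prism => /andP[/ltnW -> ->].
Qed.

(** * Corners, and reconstruction of a partition from its jumps *)

Section LastPassage.
Variable k : nat.
Implicit Types (p q : k.-tuple nat -> nat) (i : k.-tuple nat).

Definition next_max p i : nat := \max_(l < k) p (addE l i).
(** The exponent [a_i] of the overview; for a partition the truncated subtraction is exact, by
    [next_max_le]. *)
Definition jump p i : nat := p i - next_max p i.

Lemma next_max_le (p : hpartition k) i : (next_max p i <= p i)%N.
Proof. by apply/bigmax_leqP => l _; apply: hpartition_decr. Qed.

(** With heights counted from 0, [h < p i] puts the cell in the diagram, and [p (addE l i) <= h]
    keeps its [l]-th neighbour out. *)
Lemma mem_hcorners (p : hpartition k) i h :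
  (rcons_tuple i h \in hcorners p) = (next_max p i <= h < p i)%N.
Proof.
rewrite !inE /= mem_hdiagram andbC; congr (_ && _).
apply/forallP/bigmax_leqP => [nD l _|le_h l].
  by move: (nD l); rewrite addE_rcons_widen mem_hdiagram -leqNgt.
by rewrite addE_rcons_widen mem_hdiagram -leqNgt le_h.
Qed.

Variable B : {fset k.-tuple nat}.

(** The corners are listed column by column: the column above [i] has [jump p i] of them, and
    columns outside [B] are empty. *)
Lemma prod_hcorners (S : comNzRingType) (p : hpartition k)
    (F : k.+1.-tuple nat -> S) (G : k.-tuple nat -> S) :
    (finsupp p `<=` B)%fset -> (forall i h, F (rcons_tuple i h) = G i) ->
  \prod_(u <- hcorners p) F u = \prod_(i <- B) G i ^+ jump p i.
Proof.
move=> /fsubsetP pB FG.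
pose s := [seq rcons_tuple i h | i <- B, h <- iota (next_max p i) (jump p i)].
have ps : perm_eq (hcorners p) s.
  apply: uniq_perm; first exact: fset_uniq.
    apply: allpairs_uniq_dep => [|i _|]; [exact: fset_uniq|exact: iota_uniq|].
    by move=> [i h] [j g] _ _ /= /rcons_tuple_inj[-> ->].
  move=> u; case: (rcons_tupleP u) => i [h ->]; rewrite mem_hcorners.
  have E : (next_max p i <= h < next_max p i + jump p i)%N = (next_max p i <= h < p i)%N.
    by rewrite /jump subnKC // next_max_le.
  rewrite -E; apply/idP/allpairsPdep => [hi|[j [g [_]]]].
    exists i, h; rewrite mem_iota; split=> //; apply: pB; rewrite mem_finsupp.
    by move: hi; rewrite E => /andP[_ /(leq_ltn_trans (leq0n h))]; rewrite lt0n.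
  by rewrite mem_iota => gj /rcons_tuple_inj[-> ->].
rewrite (perm_big _ ps) big_allpairs_dep /=; apply: eq_bigr => i _.
under eq_bigr do rewrite FG.
by rewrite big_const_seq count_predT size_iota -Monoid.iteropE.
Qed.

Hypothesis B_down : down_closed B.

(* Fuel for the recursion: the coordinate sum grows at each step and is smaller
   than this bound on [B]. *)
Let bound : nat := \max_(i <- B) (\sum_j tnth i j).+1.
Let fuel i : nat := bound - \sum_j tnth i j.

Fixpoint last_passage_rec (a : k.-tuple nat -> nat) (m : nat) i : nat :=
  if m is m'.+1 then
    if i \in B then a i + \max_(l < k) last_passage_rec a m' (addE l i) else 0
  else 0.

(** For [i] in [B], the greatest total of [a] along a path of unit steps inside [B] that starts at
    [i]. *)
Definition last_passage a i := last_passage_rec a (fuel i) i.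

Lemma lt_bound i : i \in B -> (\sum_j tnth i j < bound)%N.
Proof.
by move=> iB; apply: (leq_bigmax_seq (F := fun i => (\sum_j tnth i j).+1)).
Qed.

(** On [B] the coordinate sum stays below [bound], so the subtraction is not truncated. A recursive
    call thus receives exactly the fuel that [last_passage] assigns to the neighbour. *)
Lemma fuelS i l : i \in B -> fuel i = (fuel (addE l i)).+1.
Proof.
by move=> iB; rewrite /fuel sum_tnth_addE -subSn ?subSS // lt_bound.
Qed.

Lemma fuel_gt0 i : i \in B -> (0 < fuel i)%N.
Proof.
by move=> iB; rewrite subn_gt0 lt_bound.
Qed.

Lemma last_passage_out a i : i \notin B -> last_passage a i = 0%N.
Proof. by rewrite /last_passage; case: fuel => //= m /negPf ->. Qed.

Lemma last_passageE a i :
  i \in B -> last_passage a i = (a i + next_max (last_passage a) i)%N.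
Proof.
move=> iB; have := fuel_gt0 iB; rewrite /last_passage.
case Ef: (fuel i) => [//|m] _ /=; rewrite iB; congr (_ + _)%N.
apply: eq_bigr => l _; congr last_passage_rec.
by move: Ef; rewrite (fuelS l iB) => -[].
Qed.

Definition last_passage_fsfun a : {fsfun k.-tuple nat -> nat with 0%N} :=
  [fsfun i in B => last_passage a i].

Lemma last_passage_fsfunE a : last_passage_fsfun a =1 last_passage a.
Proof. by move=> i; rewrite fsfun_fun; case: ifPn => // /(last_passage_out a) ->. Qed.

(** Down-closedness enters here: if [addE l i] lies in [B], so does [i], and the recursion at [i]
    dominates the value there; outside [B] the value is 0. *)
Fact last_passage_decr a : `[< weakly_decreasing (last_passage_fsfun a) >].
Proof.
apply/asboolP => i l; rewrite !last_passage_fsfunE.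
have [lB|lB] := boolP (addE l i \in B); last by rewrite (last_passage_out a lB).
rewrite (last_passageE a (B_down lB)); apply: leq_trans (leq_addl _ _).
exact: (leq_bigmax (F := fun l => last_passage a (addE l i))).
Qed.

Definition last_passage_partition a : hpartition k :=
  HPartition (last_passage_decr a).

Lemma eq_next_max p q : p =1 q -> next_max p =1 next_max q.
Proof. by move=> pq i; apply: eq_bigr. Qed.

Lemma finsupp_last_passage a : (finsupp (last_passage_partition a) `<=` B)%fset.
Proof.
apply/fsubsetP => i; rewrite mem_finsupp last_passage_fsfunE.
by apply: contra_neqT => /(last_passage_out a).
Qed.

Lemma jump_last_passage a i : i \in B -> jump (last_passage_partition a) i = a i.
Proof.
move=> iB; rewrite /jump (eq_next_max (last_passage_fsfunE a)).
by rewrite last_passage_fsfunE last_passageE // addnK.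
Qed.

(** On [B] a value is its jump plus the maximum over neighbours, which have less fuel; induction on
    fuel recovers it from the jumps. *)
Lemma hpartition_jump_inj (p q : hpartition k) :
    (finsupp p `<=` B)%fset -> (finsupp q `<=` B)%fset ->
  {in B, jump p =1 jump q} -> p = q.
Proof.
move=> /fsubsetP pB /fsubsetP qB pq; apply: val_inj; apply/fsfunP => i /=.
have out (r : hpartition k) j : {subset finsupp r <= B} -> j \notin B -> r j = 0%N.
  by move=> rB jB; apply/eqP; rewrite -[_ == _]negbK -mem_finsupp (contra (rB j)).
elim: {i}(fuel i) {-2}i (leqnn (fuel i)) => [|m IHm] i fi.
  (* Zero fuel only occurs outside [B], where both partitions vanish. *)
  have iB : i \notin B by apply/negP => /fuel_gt0; rewrite ltnNge fi.
  by rewrite !out.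
have [iB|iB] := boolP (i \in B); last by rewrite !out.
rewrite -(subnK (next_max_le p i)) -(subnK (next_max_le q i)).
congr (_ + _)%N; first exact: pq.
by apply: eq_bigr => l _; apply: IHm; rewrite -ltnS -fuelS.
Qed.

End LastPassage.

(** * The slice with first coordinate 0, as the partition with diagram sh_1 *)

Section Base.
Variable k : nat.
Implicit Types (p : hpartition k.+1) (rho : hpartition k).

Definition base_fsfun p : {fsfun k.-tuple nat -> nat with 0%N} :=
  [fsfun j in [fset behead_tuple i | i in finsupp p]%fset => p (cons_tuple 0%N j)].

Lemma base_fsfunE p j : base_fsfun p j = p (cons_tuple 0%N j).
Proof.
rewrite fsfun_fun; case: ifPn => // /imfsetP jp; apply/esym/eqP.
apply/negPn/negP => pj; apply: jp; exists (cons_tuple 0%N j); last exact: val_inj.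
by rewrite /= mem_finsupp.
Qed.

Fact base_decr p : `[< weakly_decreasing (base_fsfun p) >].
Proof.
apply/asboolP => j l; rewrite !base_fsfunE -addE_cons_lift.
exact: hpartition_decr.
Qed.

Definition base p : hpartition k := HPartition (base_decr p).

Lemma baseE p j : base p j = p (cons_tuple 0%N j).
Proof. exact: base_fsfunE. Qed.

Lemma base_max p h j : (p (cons_tuple h j) <= base p j)%N.
Proof.
rewrite baseE; elim: h => // h; apply: leq_trans.
by rewrite -addE_cons0 hpartition_decr.
Qed.

(** Every slice lies under the slice at 0 by [base_max], so forgetting the first coordinate leaves
    the diagram of that slice. *)
Lemma hdiagram_base p : hshape1 p = hdiagram (base p).
Proof.
apply/fsetP => v; apply/imfsetP/idP => [[u /= up ->]|].
  move: up; case: (cons_tupleP u) => h [i ->].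
  have -> : behead_tuple (cons_tuple h i) = i by apply: val_inj.
  case: (rcons_tupleP i) => j [g ->]; rewrite cons_rcons_tuple !mem_hdiagram.
  by move/leq_trans; apply; apply: base_max.
case: (rcons_tupleP v) => j [g ->]; rewrite mem_hdiagram baseE => gp.
exists (cons_tuple 0%N (rcons_tuple j g)); last exact: val_inj.
by rewrite cons_rcons_tuple /= mem_hdiagram.
Qed.

(** Each boxed partition is thus indexed by exactly one [rho], its base, and the double sum over
    [rho] and [p] becomes a sum over [p]. *)
Lemma gindexE (n : 'I_k.+1 -> nat) rho p :
  gindex n rho p <-> hdiagram_in_box n p /\ base p = rho.
Proof.
split=> -[np E]; split=> //; last by rewrite hdiagram_base E.
by apply: hdiagram_inj; rewrite -hdiagram_base.
Qed.

(** Links the index set of the double sum to the support condition of the last-passage construction: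
    the box bounds the first coordinate, the slice at 0 the others. *)
Lemma finsupp_sub_prism (n : 'I_k.+1 -> nat) (D : {fset k.-tuple nat}) p :
    (forall u, u \in D -> forall l, (tnth u l < n (lift ord0 l))%N) ->
  (finsupp p `<=` prism (n ord0) D)%fset <->
  hdiagram_in_box n p /\ (finsupp (base p) `<=` D)%fset.
Proof.
move=> nD; split=> [/fsubsetP pD|[np /fsubsetP pD]].
  split=> [u|].
    case: (rcons_tupleP u) => i [h ->]; rewrite mem_hdiagram => hp l.
    rewrite tnth_rcons_widen.
    have: i \in finsupp p by rewrite mem_finsupp -lt0n (leq_ltn_trans _ hp).
    move/pD; case: (cons_tupleP i) => g [j ->]; rewrite mem_prism => /andP[gn jD].
    by case: (unliftP ord0 l) => [l'|] ->; rewrite ?tnth_cons_lift ?tnth_cons0 ?nD.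
  apply/fsubsetP => j; rewrite mem_finsupp baseE => pj.
  by have := pD (cons_tuple 0%N j); rewrite mem_finsupp mem_prism => /(_ pj)/andP[].
apply/fsubsetP => i; case: (cons_tupleP i) => h [j ->]; rewrite mem_finsupp -lt0n => pj.
rewrite mem_prism; apply/andP; split.
  (* The box condition speaks of cells, so it is tested at the bottom cell of the column. *)
  have /np/(_ ord0) : rcons_tuple (cons_tuple h j) 0%N \in hdiagram p
    by rewrite mem_hdiagram.
  by rewrite tnth_rcons_widen.
by apply: pD; rewrite mem_finsupp -lt0n (leq_trans pj) ?base_max.
Qed.

End Base.

(** * The identity, coefficient by coefficient *)

Lemma xvar_coef0 (R : comNzRingType) d (n : 'I_d -> nat) (l : 'I_d) j :
  (xvar R n l j)@_0 = 0.
Proof.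
rewrite /xvar; case: insub => [j'|]; last by rewrite mcoeff0.
by rewrite mcoeffX mnm1_eq0.
Qed.

Section Identity.
Variables (R : comNzRingType) (d : nat) (n : 'I_d.+1 -> nat) (D : {fset d.-tuple nat}).
Hypothesis D_down : down_closed D.
Hypothesis D_in_box : forall u, u \in D -> forall l, (tnth u l < n (lift ord0 l))%N.

Let B := prism (n ord0) D.
Let B_down : down_closed B := prism_down_closed D_down.
Let x (i : d.+1.-tuple nat) : {mpoly R[#|vars n|]} :=
  \prod_(l < d.+1) xvar R n l (tnth i l).
Let X (i : B) : fps #|vars n| R := fps_of_mpoly (x (val i)).
Let weight (p : hpartition d.+1) : {mpoly R[#|vars n|]} :=
  \prod_(u <- hcorners p)
    \prod_(l < d.+1) xvar R n l (tnth u (widen_ord (leqnSn d.+1) l)).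

Let X0 i : fps_coef (X i) 0%MM = 0.
Proof.
rewrite /X /x big_ord_recl fps_of_mpolyM.
(* One variable already gives order 1; for the others the vacuous order 0 suffices. *)
apply: (fps_eq_upto_mul0 (N := 1) (M := 0)) => //; rewrite ?mdeg0 //.
by move=> m; rewrite ltnS leqn0 mdeg_eq0 => /eqP ->; rewrite /= xvar_coef0.
Qed.

Let coef_weight (p : hpartition d.+1) m : (finsupp p `<=` B)%fset ->
  (weight p)@_m = fps_coef (\prod_i X i ^+ jump p (val i)) m.
Proof.
move=> pB; rewrite /weight (prod_hcorners pB (G := x)); last first.
  by move=> i h; apply: eq_bigr => l _; rewrite tnth_rcons_widen.
rewrite big_seq_fsetE /= -[LHS]/(fps_coef (fps_of_mpoly _) m) fps_of_mpoly_prod.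
by congr (fps_coef _ m); apply: eq_bigr => i _; rewrite fps_of_mpolyX.
Qed.

Let extend N (a : {ffun B -> 'I_N}) (i : d.+1.-tuple nat) : nat :=
  if (insub i : option B) is Some i' then a i' else 0%N.

Let partition_of N (a : {ffun B -> 'I_N}) : hpartition d.+1 :=
  last_passage_partition B_down (extend a).

Let jump_partition_of N (a : {ffun B -> 'I_N}) (i : B) :
  jump (partition_of a) (val i) = a i.
Proof.
by rewrite jump_last_passage; [rewrite /extend valK | apply: valP].
Qed.

Let partition_of_inj N : injective (@partition_of N).
Proof.
move=> a b ab; apply/ffunP => i; apply: ord_inj.
by rewrite -!jump_partition_of ab.
Qed.

(* By [mem_Q], all partitions that can contribute to the coefficient of [m]. *)
Let Q (m : 'X_{1..#|vars n|}) : {fset hpartition d.+1} :=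
  [fset partition_of a | a in {ffun B -> 'I_(mdeg m).+1}]%fset.

Let Q_supp m (p : hpartition d.+1) : p \in Q m -> (finsupp p `<=` B)%fset.
Proof. by move=> /imfsetP[a _ ->]; apply: finsupp_last_passage. Qed.

(** A nonzero coefficient bounds every jump by [mdeg m], so the jumps form one of the functions
    indexing [Q m], and they determine [p]. *)
Let mem_Q m (p : hpartition d.+1) :
  (finsupp p `<=` B)%fset -> (weight p)@_m <> 0 -> p \in Q m.
Proof.
move=> pB; rewrite coef_weight // => nz; apply/imfsetP => /=.
have le_m (i : B) : (jump p (val i) < (mdeg m).+1)%N.
  by rewrite ltnS; apply: (fps_coef_prod_expr_neq0 _ X0 nz).
exists [ffun i => Ordinal (le_m i)] => //.
apply: (hpartition_jump_inj pB (finsupp_last_passage B_down _)) => i iB.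
by rewrite -[i]/(val [` iB]%fset) jump_partition_of ffunE.
Qed.

Let rhos : set (hpartition d) := [set rho | (hshape rho `<=` D)%fset]%classic.

(** Members of [gindex n rho] outside [Q m] contribute 0 at [m], by [mem_Q]; members of [Q m] with
    base [rho] lie in the box. *)
Let coef_grothendieck rho m : rhos rho ->
  (grothendieck R n rho)@_m = \sum_(p <- Q m | base p == rho) (weight p)@_m.
Proof.
move=> rhoD; have fin := finite_gindex n rho.
rewrite /grothendieck fsbig_finite // raddf_sum /= [RHS]big_fset_condE.
symmetry; apply: big_fset_incl => [|p].
  apply/fsubsetP => p; rewrite !inE /= => /andP[pQ /eqP pr].
  rewrite in_fset_set // inE; apply/gindexE; split=> //.
  by have /(finsupp_sub_prism _ D_in_box)[] := Q_supp pQ.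
rewrite in_fset_set // inE => /gindexE[np pr].
rewrite !inE /= pr eqxx andbT => pQ; apply: contrapT => /mem_Q pQ'.
by move/negP: pQ; apply; apply: pQ'; apply/(finsupp_sub_prism _ D_in_box); rewrite pr.
Qed.

(** No member of [Q m] lies over such a [rho]; hence only finitely many [rho] reach a given
    monomial. *)
Let mem_base_Q rho m : rhos rho ->
  rho \notin [fset base p | p in Q m]%fset -> (grothendieck R n rho)@_m = 0.
Proof.
move=> rhoD nQ; rewrite coef_grothendieck // big_seq_cond big1 // => p /andP[pQ /eqP pr].
by case/negP: nQ; rewrite -pr; apply: in_imfset.
Qed.

Lemma grothendieck_summable :
  fps_summable rhos (fun rho => fps_of_mpoly (grothendieck R n rho)).
Proof.
move=> m; apply: (@sub_finite_set _ _ [set` [fset base p | p in Q m]%fset]%classic).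
  by move=> rho [/= rhoD nz]; apply: contrapT => /negP/(mem_base_Q rhoD).
exact: finite_fset.
Qed.

Lemma grothendieck_cauchy :
  fps_sum rhos (fun rho => fps_of_mpoly (grothendieck R n rho)) =
  \prod_(i <- B) (1 - fps_of_mpoly (x i))^-1.
Proof.
apply: fpsP => m.
have sub rho : rho \in [fset base p | p in Q m]%fset -> rhos rho.
  move=> /imfsetP[p /= pQ ->].
  by have /(finsupp_sub_prism _ D_in_box)[] := Q_supp pQ.
rewrite /= (fsbigE [fset base p | p in Q m]%fset) ?fset_uniq //; last first.
  by move=> rho; apply: mem_base_Q.
(* Both sides equal one sum over [Q m]; the left side is that sum grouped by the fibres of
   [base]. *)
transitivity (\sum_(p <- Q m) (weight p)@_m).
  rewrite (partition_big_imfset _ (@base d)) /= big_seq_cond [RHS]big_seq_cond.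
  apply: eq_big => rho; last by move=> /andP[/sub rhoD _]; apply: coef_grothendieck.
  by apply: andb_id2l => /sub rhoD; rewrite mem_set.
(* With [N = (mdeg m).+1] the expanded product runs over the same functions that index [Q m], and
   these match partitions one to one. *)
rewrite [in RHS]big_seq_fsetE /= (fps_coef_prod_inv X0 (ltnSn _)).
rewrite big_imfset /=; last first.
  by move=> a b _ _; apply: partition_of_inj.
under eq_bigr => a _ do rewrite (coef_weight _ (finsupp_last_passage B_down _)).
under eq_bigr => a _ do under eq_bigr do rewrite jump_partition_of.
by rewrite big_enum.
Qed.

End Identity.

(* d = e.+2 *)
Theorem theorem6p4 (R : comNzRingType) (e : nat) (n : 'I_e.+2 -> nat)
    (n_gt0 : forall k, (0 < n k)%N)
    (eta : hpartition e)
    (eta_in_box : forall u, u \in hdiagram eta ->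
       forall l : 'I_e.+1, (tnth u l < n (lift ord0 l))%N) :
  let rhos := [set rho : hpartition e.+1 | (hshape rho `<=` hdiagram eta)%fset]%classic in
  let g rho := fps_of_mpoly (grothendieck R n rho) in
  fps_summable rhos g /\
  fps_sum rhos g =
    \prod_(u <- prism (n ord0) (hdiagram eta))
      (1 - fps_of_mpoly (\prod_(k < e.+2) xvar R n k (tnth u k)))^-1.
Proof.
have eta_down := @hdiagram_down_closed _ eta.
by split; [apply: grothendieck_summable | apply: grothendieck_cauchy].
Qed.
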